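(* Let $W^L=[\rho^L,u^L,p^L]$ be connected to a star state $W^*$ situated to its right by a left-facing rarefaction wave, i.e. the specific entropy $s_{\mathrm h}$ is constant across the wave, and let $\rho^*\le\rho^L$ be the density of the star state and $p_{\mathrm h}^*$ its hydrodynamical pressure. Set $$f^R(p_{\mathrm h}^*;W^L):=\int_{\rho^L}^{\rho^*}\frac{\sqrt{a_{\mathrm h}^2(\rho,e_{\mathrm h})+a_{\mathrm b}^2(\rho)}}{\rho}\Big|_{s_{\mathrm h}}d\rho,\qquad f^R_{\mathrm h}(p_{\mathrm h}^*;W^L):=\int_{\rho^L}^{\rho^*}\frac{a_{\mathrm h}(\rho,e_{\mathrm h})}{\rho}\Big|_{s_{\mathrm h}}d\rho,$$ where $e_{\mathrm h}$ is understood as a function of $\rho$ along the isentrope through $W^L$. Then $$f^R(p_{\mathrm h}^*;W^L)\le f^R_{\mathrm h}(p_{\mathrm h}^*;W^L)\le0,$$ and the head of the rarefaction fan travels at speed $$\lambda_1^-=u^L-\sqrt{a_{\mathrm h}^2\big(\rho^L,e_{\mathrm h}(\rho^L,p_{\mathrm h}^L)\big)+a_{\mathrm b}^2(\rho^L)}.$$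
   Context: The one-dimensional compressible Euler equations are closed by the total pressure $p=p_{\mathrm h}(\rho,e_{\mathrm h})+p_{\mathrm b}(\rho)$, where $p_{\mathrm h}$ is a complete equation of state in density and specific internal energy $e_{\mathrm h}$, with specific entropy $s_{\mathrm h}$ and sound speed $a_{\mathrm h}$, satisfying $a_{\mathrm h}^2=-v^2\partial_v\hat p_{\mathrm h}|_{s_{\mathrm h}}>0$ ($v=1/\rho$), and $p_{\mathrm b}(\rho)=\rho^2\partial_\rho e_{\mathrm b}(\rho)$ with $e_{\mathrm b}$ a $C^3$ function satisfying $a_{\mathrm b}^2(\rho):=\partial_\rho p_{\mathrm b}(\rho)\ge0$. A state $W=[\rho,u,p]$ has hydrodynamical pressure $p_{\mathrm h}=p-p_{\mathrm b}(\rho)$. The left-facing characteristic speed of the full system is $u-\sqrt{a_{\mathrm h}^2+a_{\mathrm b}^2}$; the fan occupies the range of characteristic speeds from its head (at $W^L$, the state bounding the fan on the left) to its tail (at $W^*$). *)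

(* Defs.v *)
From Stdlib Require Import Reals.
From Coquelicot Require Import Coquelicot.
Open Scope R_scope.

(* Hydrodynamical equation of state.  [s_h], [p_h], [T_h] are functions of
   (rho, e_h) on the set [dom] of admissible pairs; [e_vs] is the internal energy
   in the variables (v, s_h), with v = 1/rho, and [e_rp] is the internal energy
   in the variables (rho, p_h). *)
Record eos := Eos {
  dom : R -> R -> Prop;
  p_h : R -> R -> R;
  s_h : R -> R -> R;
  T_h : R -> R -> R;
  e_vs : R -> R -> R;
  e_rp : R -> R -> R
}.

Definition p_hat (E : eos) (v s : R) : R := p_h E (1 / v) (e_vs E v s).

(* a_h^2 = - v^2 (d p_hat / dv) at constant s_h *)
Definition a_h2 (E : eos) (rho e : R) : R :=
  - (1 / rho) ^ 2 * Derive (fun v => p_hat E v (s_h E rho e)) (1 / rho).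

Definition a_h (E : eos) (rho e : R) : R := sqrt (a_h2 E rho e).

(* The two Gibbs fields together say de = T ds - p dv. *)
Record complete_eos (E : eos) : Prop := CompleteEos {
  dom_open : forall rho e, dom E rho e -> locally_2d (dom E) rho e;
  dom_pos : forall rho e, dom E rho e -> 0 < rho;
  e_rpK : forall rho e, dom E rho e -> e_rp E rho (p_h E rho e) = e;
  e_vsK : forall rho e, dom E rho e -> e_vs E (1 / rho) (s_h E rho e) = e;
  s_hK : forall rho e, dom E rho e ->
    locally_2d (fun v s => dom E (1 / v) (e_vs E v s) /\
                           s_h E (1 / v) (e_vs E v s) = s)
               (1 / rho) (s_h E rho e);
  gibbs_v : forall rho e, dom E rho e ->
    is_derive (fun v => e_vs E v (s_h E rho e)) (1 / rho) (- p_h E rho e);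
  gibbs_s : forall rho e, dom E rho e ->
    is_derive (fun s => e_vs E (1 / rho) s) (s_h E rho e) (T_h E rho e);
  T_h_pos : forall rho e, dom E rho e -> 0 < T_h E rho e;
  p_h_C1 : forall rho e, dom E rho e ->
    ex_derive (fun r => p_h E r e) rho /\
    ex_derive (fun e' => p_h E rho e') e /\
    continuity_2d_pt (fun r e' => Derive (fun r' => p_h E r' e') r) rho e /\
    continuity_2d_pt (fun r e' => Derive (fun e'' => p_h E r e'') e') rho e;
  a_h2_pos : forall rho e, dom E rho e -> 0 < a_h2 E rho e
}.

Definition p_b (eb : R -> R) (rho : R) : R := rho ^ 2 * Derive eb rho.

Definition a_b2 (eb : R -> R) (rho : R) : R := Derive (p_b eb) rho.

Record barotropic_energy (eb : R -> R) : Prop := BarotropicEnergy {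
  eb_ex_derive : forall (k : nat) rho, (k <= 3)%nat -> 0 < rho ->
    ex_derive_n eb k rho;
  eb_C3 : forall rho, 0 < rho -> continuous (Derive_n eb 3) rho;
  a_b2_nonneg : forall rho, 0 < rho -> 0 <= a_b2 eb rho
}.

Record state := State { rho : R; vel : R; pres : R }.

Definition pres_h (eb : R -> R) (W : state) : R := pres W - p_b eb (rho W).

Definition energy_h (E : eos) (eb : R -> R) (W : state) : R :=
  e_rp E (rho W) (pres_h eb W).

Definition entropy_h (E : eos) (eb : R -> R) (W : state) : R :=
  s_h E (rho W) (energy_h E eb W).

Definition admissible (E : eos) (eb : R -> R) (W : state) : Prop :=
  dom E (rho W) (energy_h E eb W) /\
  p_h E (rho W) (energy_h E eb W) = pres_h eb W.

Inductive law := Mass | Momentum | Energy.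

(* Total energy per unit volume: the internal energy is e_h + e_b. *)
Definition total_energy (eb : R -> R) (r u e : R) : R :=
  r * (e + eb r + u ^ 2 / 2).

Definition conserved (eb : R -> R) (k : law) (r u e : R) : R :=
  match k with
  | Mass => r
  | Momentum => r * u
  | Energy => total_energy eb r u e
  end.

Definition flux (E : eos) (eb : R -> R) (k : law) (r u e : R) : R :=
  let p := p_h E r e + p_b eb r in
  match k with
  | Mass => r * u
  | Momentum => r * u ^ 2 + p
  | Energy => u * (total_energy eb r u e + p)
  end.

Definition conserved_at (E : eos) (eb : R -> R) (k : law) (W : state) : R :=
  conserved eb k (rho W) (vel W) (energy_h E eb W).

Definition flux_at (E : eos) (eb : R -> R) (k : law) (W : state) : R :=
  flux E eb k (rho W) (vel W) (energy_h E eb W).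

(* The Euler equations d_t U + d_x F(U) = 0, in the classical sense, at (t, x). *)
Definition euler_at (E : eos) (eb : R -> R) (W : R -> R -> state) (t x : R) : Prop :=
  forall k : law, exists d : R,
    is_derive (fun t' => conserved_at E eb k (W t' x)) t (- d) /\
    is_derive (fun x' => flux_at E eb k (W t x')) x d.

(* lambda is an eigenvalue of the flux Jacobian dF/dU.  In the coordinates
   (rho, u, e_h) an eigenvector is r <> 0 with DF r = lambda DU r, where DU and DF
   are computed as derivatives along the line through the state in direction r. *)
Definition characteristic_speed (E : eos) (eb : R -> R) (W : state) (lambda : R)
    : Prop :=
  exists r1 r2 r3 : R, (r1, r2, r3) <> (0, 0, 0) /\
  forall k : law, exists d : R,
    is_derive (fun h => conserved eb k (rho W + h * r1) (vel W + h * r2)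
                                  (energy_h E eb W + h * r3)) 0 d /\
    is_derive (fun h => flux E eb k (rho W + h * r1) (vel W + h * r2)
                             (energy_h E eb W + h * r3)) 0 (lambda * d).

(* Left-facing: travelling to the left relative to the fluid. *)
Definition left_characteristic_speed (E : eos) (eb : R -> R) (W : state)
    (lambda : R) : Prop :=
  characteristic_speed E eb W lambda /\ lambda < vel W.

(* Centred left-facing rarefaction (t, x) |-> w (x / t) from WL (on the left) to
   Ws (on the right); [head] and [tail] are the speeds of the two edges of the
   fan.  The degenerate fan head = tail (WL = Ws) is allowed. *)
Record left_rarefaction (E : eos) (eb : R -> R) (WL Ws : state) (head tail : R)
    (w : R -> state) : Prop := LeftRarefaction {
  fan_range : head <= tail;
  fan_left : forall xi, xi <= head -> w xi = WL;
  fan_right : forall xi, tail <= xi -> w xi = Ws;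
  fan_continuous : forall xi, continuous (fun y => rho (w y)) xi /\
    continuous (fun y => vel (w y)) xi /\ continuous (fun y => pres (w y)) xi;
  fan_admissible : forall xi, admissible E eb (w xi);
  fan_euler : forall t x, 0 < t -> head < x / t < tail ->
    euler_at E eb (fun t' x' => w (x' / t')) t x;
  fan_characteristic : forall xi, head <= xi <= tail ->
    left_characteristic_speed E eb (w xi) xi;
  fan_isentropic : forall xi, entropy_h E eb (w xi) = entropy_h E eb WL
}.

(* Internal energy as a function of density along the isentrope through WL. *)
Definition isentrope (E : eos) (eb : R -> R) (WL : state) (r : R) : R :=
  e_vs E (1 / r) (entropy_h E eb WL).

(* The star state enters f^R and f^R_h through its density [rho_s]. *)
Definition f_R (E : eos) (eb : R -> R) (WL : state) (rho_s : R) : R :=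
  RInt (fun r => sqrt (a_h2 E r (isentrope E eb WL r) + a_b2 eb r) / r)
       (rho WL) rho_s.

Definition f_R_h (E : eos) (eb : R -> R) (WL : state) (rho_s : R) : R :=
  RInt (fun r => a_h E r (isentrope E eb WL r) / r) (rho WL) rho_s.

(* Main.v *)
Require Import Defs.
From Stdlib Require Import Reals Lra.
From Coquelicot Require Import Coquelicot.
Open Scope R_scope.

(* In the coordinates (rho, e_h) the Gibbs relation gives
   a_h^2 = d_rho p_h + (p_h / rho^2) d_e p_h.  Hence a_h^2 is continuous along the
   isentrope, and the eigenvector equations force (lambda - u)^2 = a_h^2 + a_b^2
   for every characteristic speed lambda <> u.  Every density between rho^* and
   rho^L is attained inside the fan by the intermediate value theorem, so the
   isentrope stays in the domain of the equation of state there and the integrands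
   of f^R and f^R_h, which are ordered pointwise, are integrable. *)

(** * Differential calculus of the equation of state *)

Definition p_h_rho (E : eos) (r e : R) : R := Derive (fun r' => p_h E r' e) r.
Definition p_h_e (E : eos) (r e : R) : R := Derive (fun e' => p_h E r e') e.

Lemma one_div_one_div (x : R) : 1 / (1 / x) = x.
Proof. unfold Rdiv; now rewrite !Rmult_1_l, Rinv_inv. Qed.

Lemma continuous_along (f : R -> R -> R) (g h : R -> R) (t : R) :
  continuity_2d_pt f (g t) (h t) -> continuous g t -> continuous h t ->
  continuous (fun x => f (g x) (h x)) t.
Proof.
intros Hf Hg Hh.
apply (continuous_comp_2 g h f t Hg Hh).
now apply continuity_2d_pt_filterlim in Hf.
Qed.

Lemma is_derive_continuous (f : R -> R) (x l : R) :
  is_derive f x l -> continuous f x.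
Proof.
intros H; apply (ex_derive_continuous (V := R_NormedModule)); now exists l.
Qed.

Lemma is_derive_inj (f : R -> R) (x a b : R) :
  is_derive f x a -> is_derive f x b -> a = b.
Proof.
intros Ha Hb; apply is_derive_unique in Ha; apply is_derive_unique in Hb.
congruence.
Qed.

(** Openness of [dom] provides the partial derivative in density on a whole neighbourhood. Its
    continuity at the point, with the existence of the partial derivative in energy there, gives
    total differentiability, hence a chain rule along curves. *)
Lemma p_h_differentiable (E : eos) (hE : complete_eos E) (r e : R) :
  dom E r e ->
  differentiable_pt_lim (p_h E) r e (p_h_rho E r e) (p_h_e E r e).
Proof.
intros Hd.
destruct (p_h_C1 E hE r e Hd) as (_ & He & Hc & _).
apply filterdiff_differentiable_pt_lim.
apply (is_derive_filterdiff (p_h E) r e (p_h_rho E) (p_h_e E r e)).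
- generalize (dom_open E hE r e Hd); intros Ho.
  apply locally_2d_locally in Ho; revert Ho.
  apply filter_imp; intros u Hu.
  apply Derive_correct, (p_h_C1 E hE _ _ Hu).
- now apply Derive_correct.
- now apply continuity_2d_pt_filterlim in Hc.
Qed.

Lemma is_derive_p_h_along (E : eos) (hE : complete_eos E) (g h : R -> R)
  (t dg dh : R) :
  dom E (g t) (h t) -> is_derive g t dg -> is_derive h t dh ->
  is_derive (fun x => p_h E (g x) (h x)) t
    (p_h_rho E (g t) (h t) * dg + p_h_e E (g t) (h t) * dh).
Proof.
intros Hd Hg Hh.
apply is_derive_Reals, derivable_pt_lim_comp_2d.
- now apply p_h_differentiable.
- now apply is_derive_Reals.
- now apply is_derive_Reals.
Qed.

(** Chain rule along the curve [v] to [(1 / v, e_vs E v s)]: the density has derivative [- r ^ 2]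
    and, by the Gibbs relation, the energy has derivative [- p_h E r e]. The factor [- (1 / r) ^ 2]
    does the rest. *)
Lemma a_h2E (E : eos) (hE : complete_eos E) (r e : R) :
  dom E r e -> a_h2 E r e = p_h_rho E r e + p_h_e E r e * p_h E r e / r ^ 2.
Proof.
intros Hd.
assert (Hr := dom_pos E hE r e Hd).
assert (Hev := e_vsK E hE r e Hd).
unfold a_h2, p_hat.
rewrite (is_derive_unique _ _
  (p_h_rho E r e * (- r ^ 2) + p_h_e E r e * (- p_h E r e))).
- field; lra.
- generalize (is_derive_p_h_along E hE (fun v => 1 / v)
    (fun v => e_vs E v (s_h E r e)) (1 / r) (- r ^ 2) (- p_h E r e)).
  cbv beta; rewrite one_div_one_div, Hev; intros H; apply H.
  + exact Hd.
  + auto_derive.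
    * apply Rgt_not_eq, Rdiv_lt_0_compat; lra.
    * field; lra.
  + now apply gibbs_v.
Qed.

(** * Regularity of the barotropic pressure *)

Lemma barotropic_derivatives (eb : R -> R) (hb : barotropic_energy eb) (r : R) :
  0 < r ->
  ex_derive eb r /\ ex_derive (Derive eb) r /\ ex_derive (Derive (Derive eb)) r.
Proof.
intros Hr; repeat split.
- exact (eb_ex_derive eb hb 1 r ltac:(auto) Hr).
- exact (eb_ex_derive eb hb 2 r ltac:(auto) Hr).
- exact (eb_ex_derive eb hb 3 r ltac:(auto) Hr).
Qed.

Lemma is_derive_p_b (eb : R -> R) (hb : barotropic_energy eb) (r : R) :
  0 < r ->
  is_derive (p_b eb) r (2 * r * Derive eb r + r ^ 2 * Derive (Derive eb) r).
Proof.
intros Hr.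
destruct (barotropic_derivatives eb hb r Hr) as (_ & H2 & _).
unfold p_b; auto_derive; [exact H2 | change (fun x => Derive eb x) with (Derive eb); ring].
Qed.

(** Near a positive density [a_b2] agrees with the explicit derivative of [p_b], which is
    differentiable because [eb] has three derivatives. *)
Lemma continuous_a_b2 (eb : R -> R) (hb : barotropic_energy eb) (r : R) :
  0 < r -> continuous (a_b2 eb) r.
Proof.
intros Hr.
destruct (barotropic_derivatives eb hb r Hr) as (_ & H2 & H3).
apply (continuous_ext_loc _
  (fun r => 2 * r * Derive eb r + r ^ 2 * Derive (Derive eb) r)).
- generalize (open_gt 0 r Hr); apply filter_imp; intros y Hy.
  symmetry; now apply is_derive_unique, is_derive_p_b.
- apply (ex_derive_continuous (V := R_NormedModule)).
  auto_derive; auto.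
Qed.

(** * The isentrope through [WL], then the characteristic speeds *)

Lemma is_derive_isentrope (E : eos) (hE : complete_eos E) (eb : R -> R)
  (WL : state) (r e : R) :
  dom E r e -> s_h E r e = entropy_h E eb WL ->
  is_derive (isentrope E eb WL) r (p_h E r e / r ^ 2).
Proof.
intros Hd Hs.
assert (Hr := dom_pos E hE r e Hd).
unfold isentrope; rewrite <- Hs.
replace (p_h E r e / r ^ 2) with (scal (- / r ^ 2) (- p_h E r e))
  by (unfold scal; simpl; unfold mult; simpl; field; lra).
apply (is_derive_comp (fun v => e_vs E v (s_h E r e)) (fun x => 1 / x)).
- now apply gibbs_v.
- auto_derive; [lra | field; lra].
Qed.

(** The neighbourhood in [(v, s)] given by [s_hK] is sliced at the fixed entropy and pulled back
    through the continuous map [x] to [1 / x]. *)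
Lemma isentrope_dom_near (E : eos) (hE : complete_eos E) (eb : R -> R)
  (WL : state) (r e : R) :
  dom E r e -> s_h E r e = entropy_h E eb WL ->
  locally r (fun x => dom E x (isentrope E eb WL x)).
Proof.
intros Hd Hs.
assert (Hr := dom_pos E hE r e Hd).
assert (Hv : locally (1 / r)
  (fun v => dom E (1 / v) (e_vs E v (entropy_h E eb WL)))).
{ generalize (locally_2d_1d_const_y _ _ _ (s_hK E hE r e Hd)).
  rewrite Hs; apply filter_imp; intros v; tauto. }
assert (Hc : continuous (fun x => 1 / x) r).
{ apply (ex_derive_continuous (V := R_NormedModule)); auto_derive; lra. }
generalize (Hc _ Hv); unfold filtermap; apply filter_imp; intros x H.
rewrite one_div_one_div in H.
exact H.
Qed.

(** The formula of [a_h2E] involves only continuous quantities, and it represents [a_h2] on a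
    neighbourhood because the isentrope stays in [dom] near [r]. *)
Lemma continuous_a_h2_isentrope (E : eos) (hE : complete_eos E) (eb : R -> R)
  (WL : state) (r e : R) :
  dom E r e -> s_h E r e = entropy_h E eb WL ->
  continuous (fun x => a_h2 E x (isentrope E eb WL x)) r.
Proof.
intros Hd Hs.
assert (Hr := dom_pos E hE r e Hd).
assert (Hi : continuous (isentrope E eb WL) r)
  by (eapply is_derive_continuous, is_derive_isentrope; eauto).
assert (Hie : isentrope E eb WL r = e)
  by (unfold isentrope; rewrite <- Hs; now apply e_vsK).
apply (continuous_ext_loc _ (fun x =>
  p_h_rho E x (isentrope E eb WL x) +
  p_h_e E x (isentrope E eb WL x) * p_h E x (isentrope E eb WL x) * / x ^ 2)).
- generalize (isentrope_dom_near E hE eb WL r e Hd Hs).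
  apply filter_imp; intros x Hx; symmetry; now apply a_h2E.
- destruct (p_h_C1 E hE r e Hd) as (_ & _ & Hc1 & Hc2).
  apply (continuous_plus (V := R_NormedModule)).
  { apply (continuous_along (p_h_rho E) (fun x => x)); auto.
    - now rewrite Hie.
    - apply continuous_id. }
  apply (continuous_mult (K := R_AbsRing)).
  + apply (continuous_mult (K := R_AbsRing)).
    * apply (continuous_along (p_h_e E) (fun x => x)); auto.
      -- now rewrite Hie.
      -- apply continuous_id.
    * eapply is_derive_continuous.
      apply (is_derive_p_h_along E hE (fun x => x)).
      -- now rewrite Hie.
      -- apply is_derive_Reals, derivable_pt_lim_id.
      -- eapply is_derive_isentrope; eauto.
  + apply (ex_derive_continuous (V := R_NormedModule)); auto_derive.
    nra.
Qed.

(* The eigenvector equations reduce to rho r2 = c r1, r3 = p_h r1 / rho^2 and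
   dp = c^2 r1 with c = lambda - u <> 0. *)
Lemma characteristic_speed_sqr (E : eos) (hE : complete_eos E) (eb : R -> R)
  (hb : barotropic_energy eb) (W : state) (lambda : R) :
  dom E (rho W) (energy_h E eb W) ->
  characteristic_speed E eb W lambda -> lambda <> vel W ->
  (lambda - vel W) ^ 2 = a_h2 E (rho W) (energy_h E eb W) + a_b2 eb (rho W).
Proof.
intros Hd (r1 & r2 & r3 & Hnz & Hev) Hne.
rewrite (a_h2E E hE _ _ Hd).
set (e := energy_h E eb W) in *; set (r := rho W) in *; set (u := vel W) in *.
assert (Hr : 0 < r) by exact (dom_pos E hE r e Hd).
destruct (barotropic_derivatives eb hb r Hr) as (Hb & _).
assert (Db := is_derive_p_b eb hb r Hr).
replace (a_b2 eb r) with (2 * r * Derive eb r + r ^ 2 * Derive (Derive eb) r)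
  by (symmetry; now apply is_derive_unique).
set (q := 2 * r * Derive eb r + r ^ 2 * Derive (Derive eb) r) in *.
(* [q] is the value of [a_b2], and [dp] is the derivative of the total pressure in the direction
   [(r1, r2, r3)]. *)
set (dp := p_h_rho E r e * r1 + p_h_e E r e * r3 + q * r1).
assert (Dline : forall a b, is_derive (fun h => a + h * b) 0 b)
  by (intros a b; auto_derive; [exact I | ring]).
assert (Hpt : forall a b : R, a + 0 * b = a) by (intros; ring).
assert (Dph : is_derive (fun h => p_h E (r + h * r1) (e + h * r3)) 0
  (p_h_rho E r e * r1 + p_h_e E r e * r3)).
{ generalize (is_derive_p_h_along E hE (fun h => r + h * r1)
    (fun h => e + h * r3) 0 r1 r3).
  cbv beta; rewrite !Hpt; auto. }
assert (Dpb : is_derive (fun h => p_b eb (r + h * r1)) 0 (q * r1)).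
{ replace (q * r1) with (scal r1 q)
    by (unfold scal; simpl; unfold mult; simpl; ring).
  apply (is_derive_comp (p_b eb) (fun h => r + h * r1)); auto.
  now rewrite Hpt. }
assert (Dp : is_derive
  (fun h => p_h E (r + h * r1) (e + h * r3) + p_b eb (r + h * r1)) 0 dp)
  by exact (is_derive_plus (K := R_AbsRing) (V := R_NormedModule) _ _ _ _ _ Dph Dpb).
assert (Dte : is_derive
  (fun h => total_energy eb (r + h * r1) (u + h * r2) (e + h * r3)) 0
  (r1 * (e + eb r + u ^ 2 / 2) + r * (r3 + Derive eb r * r1 + u * r2))).
{ unfold total_energy; auto_derive; rewrite !Hpt; [auto|].
  change (fun x => eb x) with eb; field. }
assert (Dmom : is_derive (fun h => (r + h * r1) * (u + h * r2)) 0
  (r1 * u + r * r2)) by (auto_derive; auto; ring).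
(* For each law, uniqueness of derivatives identifies [d] and turns the eigenvector condition into
   an algebraic equation. *)
assert (Emass : r1 * u + r * r2 = lambda * r1).
{ destruct (Hev Mass) as (d & H1 & H2).
  rewrite (is_derive_inj _ _ _ _ H1 (Dline r r1)) in H2.
  exact (is_derive_inj _ _ _ _ Dmom H2). }
assert (Emom : r1 * u ^ 2 + 2 * r * u * r2 + dp = lambda * (r1 * u + r * r2)).
{ destruct (Hev Momentum) as (d & H1 & H2).
  rewrite (is_derive_inj _ _ _ _ H1 Dmom) in H2.
  refine (is_derive_inj _ _ _ _ _ H2); unfold flux.
  apply (is_derive_plus (K := R_AbsRing) (V := R_NormedModule)); [|exact Dp].
  auto_derive; auto; ring. }
assert (Een : r2 * (total_energy eb r u e + (p_h E r e + p_b eb r)) +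
    u * ((r1 * (e + eb r + u ^ 2 / 2) + r * (r3 + Derive eb r * r1 + u * r2))
         + dp) =
  lambda * (r1 * (e + eb r + u ^ 2 / 2)
            + r * (r3 + Derive eb r * r1 + u * r2))).
{ destruct (Hev Energy) as (d & H1 & H2).
  rewrite (is_derive_inj _ _ _ _ H1 Dte) in H2.
  refine (is_derive_inj _ _ _ _ _ H2); unfold flux.
  assert (Dsum := is_derive_plus (K := R_AbsRing) (V := R_NormedModule)
    _ _ _ _ _ Dte Dp).
  generalize (is_derive_mult (K := R_AbsRing) _ _ _ _ _ (Dline u r2) Dsum Rmult_comm).
  unfold plus, mult; simpl; rewrite !Hpt; auto. }
unfold total_energy, p_b in Een.
set (c := lambda - u).
assert (Hc : c <> 0) by (unfold c; lra).
assert (Hl : lambda = c + u) by (unfold c; ring).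
assert (E2 : r * r2 = c * r1) by (rewrite Hl in Emass; lra).
assert (Edp : dp = c ^ 2 * r1).
{ replace dp with (lambda * (r1 * u + r * r2) - r1 * u ^ 2 - 2 * u * (r * r2))
    by lra.
  rewrite E2, Hl; ring. }
assert (E3 : r2 * p_h E r e = c * r * r3).
{ rewrite Hl in Een; apply Rminus_diag_eq in Een.
  apply Rminus_diag_uniq; rewrite <- Een.
  set (K := e + eb r + u ^ 2 / 2).
  (* The energy residual is the target plus multiples of the mass residual [r * r2 - c * r1] and the
     momentum residual [dp - c ^ 2 * r1], both zero. The term [r2 * p_b] is absorbed by the mass
     multiple since [p_b] is [r ^ 2 * Derive eb r]. *)
  transitivity (r2 * p_h E r e - c * r * r3
    + (K + r * Derive eb r - c * u) * (r * r2 - c * r1)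
    + u * (dp - c ^ 2 * r1)); [rewrite E2, Edp|]; ring. }
assert (E3' : r3 = p_h E r e / r ^ 2 * r1).
{ apply (Rmult_eq_reg_l (c * r)); [rewrite <- E3|].
  2: apply Rmult_integral_contrapositive_currified; lra.
  replace r2 with (c * r1 / r) by (rewrite <- E2; field; lra).
  field; lra. }
(* If [r1] vanished, then so would [r2] and [r3], against the eigenvector being nonzero. *)
assert (Hr1 : r1 <> 0).
{ intros H0; apply Hnz; rewrite E3', H0.
  assert (H2 : r2 = 0) by (apply (Rmult_eq_reg_l r); [rewrite E2, H0; ring | lra]).
  now rewrite H2, Rmult_0_r. }
apply (Rmult_eq_reg_r r1); [|exact Hr1].
rewrite <- Edp; unfold dp; rewrite E3'; field; lra.
Qed.

Lemma fan_attains_density (E : eos) (eb : R -> R) (WL Ws : state) (head tail : R)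
  (w : R -> state) (hfan : left_rarefaction E eb WL Ws head tail w) (r : R) :
  rho Ws <= r <= rho WL -> exists xi, rho (w xi) = r.
Proof.
intros Hr.
destruct (IVT_gen (fun xi => rho (w xi)) head tail r) as (xi & _ & H).
- intros xi; apply continuity_pt_filterlim.
  exact (proj1 (fan_continuous _ _ _ _ _ _ _ hfan xi)).
- rewrite (fan_left _ _ _ _ _ _ _ hfan head), (fan_right _ _ _ _ _ _ _ hfan tail)
    by apply Rle_refl.
  rewrite Rmin_right, Rmax_left; lra.
- now exists xi.
Qed.

Theorem proposition3p23 (E : eos) (eb : R -> R)
  (hE : complete_eos E) (hb : barotropic_energy eb)
  (WL Ws : state) (head tail : R) (w : R -> state)
  (hfan : left_rarefaction E eb WL Ws head tail w)
  (hrho : rho Ws <= rho WL) :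
  f_R E eb WL (rho Ws) <= f_R_h E eb WL (rho Ws) <= 0 /\
  head = vel WL - sqrt (a_h2 E (rho WL) (e_rp E (rho WL) (pres_h eb WL))
                        + a_b2 eb (rho WL)).
Proof.
assert (Hiso : forall r, rho Ws <= r <= rho WL ->
  exists e, dom E r e /\ s_h E r e = entropy_h E eb WL).
{ intros r Hr.
  destruct (fan_attains_density _ _ _ _ _ _ _ hfan r Hr) as (xi & <-).
  exists (energy_h E eb (w xi)); split.
  - apply (fan_admissible _ _ _ _ _ _ _ hfan xi).
  - exact (fan_isentropic _ _ _ _ _ _ _ hfan xi). }
split.
- set (F := fun r => sqrt (a_h2 E r (isentrope E eb WL r) + a_b2 eb r) / r).
  set (G := fun r => a_h E r (isentrope E eb WL r) / r).
  assert (HF : ex_RInt F (rho Ws) (rho WL)).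
  { apply (ex_RInt_continuous (V := R_CompleteNormedModule)).
    rewrite Rmin_left, Rmax_right by assumption; intros r Hr.
    destruct (Hiso r Hr) as (e & Hd & Hs).
    assert (Hpos := dom_pos E hE r e Hd).
    apply (continuous_mult (K := R_AbsRing)).
    - apply continuous_sqrt_comp, (continuous_plus (V := R_NormedModule)).
      + eapply continuous_a_h2_isentrope; eauto.
      + now apply continuous_a_b2.
    - apply continuous_Rinv; lra. }
  assert (HG : ex_RInt G (rho Ws) (rho WL)).
  { apply (ex_RInt_continuous (V := R_CompleteNormedModule)).
    rewrite Rmin_left, Rmax_right by assumption; intros r Hr.
    destruct (Hiso r Hr) as (e & Hd & Hs).
    assert (Hpos := dom_pos E hE r e Hd).
    apply (continuous_mult (K := R_AbsRing)).
    - apply continuous_sqrt_comp; eapply continuous_a_h2_isentrope; eauto.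
    - apply continuous_Rinv; lra. }
  assert (Hpos : forall r, rho Ws < r < rho WL -> 0 < r).
  { intros r Hr; destruct (Hiso r ltac:(lra)) as (e & Hd & _).
    exact (dom_pos E hE r e Hd). }
  unfold f_R, f_R_h; fold F; fold G.
  (* The integrals run downwards from [rho WL] to [rho Ws]. Reversing them changes the sign, so the
     larger integrand [F] yields the smaller value. *)
  rewrite <- (opp_RInt_swap F), <- (opp_RInt_swap G) by assumption.
  assert (HGF : RInt G (rho Ws) (rho WL) <= RInt F (rho Ws) (rho WL)).
  { apply RInt_le; auto; intros r Hr.
    assert (H0 := Hpos r Hr).
    apply Rmult_le_compat_r; [now apply Rlt_le, Rinv_0_lt_compat|].
    apply sqrt_le_1_alt.
    generalize (a_b2_nonneg eb hb r H0); lra. }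
  assert (HG0 : 0 <= RInt G (rho Ws) (rho WL)).
  { apply RInt_ge_0; auto; intros r Hr.
    apply Rmult_le_pos; [apply sqrt_pos|].
    now apply Rlt_le, Rinv_0_lt_compat, Hpos. }
  unfold opp; simpl; lra.
(* The head belongs to the closed fan, where the state is still [WL], so [head] is a left-facing
   characteristic speed of [WL]. *)
- destruct (fan_characteristic _ _ _ _ _ _ _ hfan head) as [Hch Hlt].
  { generalize (fan_range _ _ _ _ _ _ _ hfan); lra. }
  destruct (fan_admissible _ _ _ _ _ _ _ hfan head) as [Hd _].
  rewrite (fan_left _ _ _ _ _ _ _ hfan head) in * by apply Rle_refl.
  fold (energy_h E eb WL).
  rewrite <- (characteristic_speed_sqr E hE eb hb WL head) by (auto; lra).
  (* Since [head < vel WL], the square is written with the nonnegative base [vel WL - head], which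
     selects the minus sign before the root. *)
  replace ((head - vel WL) ^ 2) with (Rsqr (vel WL - head))
    by (unfold Rsqr; ring).
  rewrite sqrt_Rsqr; lra.
Qed.
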